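(* There exists a one-to-one group homomorphism $h:\mathcal{G}_{(01)^\infty}\to[[\sigma|\Omega(\xi_{\mathrm{Mu}})]]$ such that $h(a)=\delta_a$, $h(c)=\delta_c$ and $h(d)=\delta_d$, where $c=c_{(01)^\infty}$ and $d=d_{(01)^\infty}$.
   Context: The group. Let $\mathbb{N}=\{1,2,\dots\}$. For $\omega\in\{0,1,2\}^{\mathbb{N}}$, $\mathcal{G}_\omega$ is the group of transformations of $\{0,1\}^{\mathbb{N}}$ generated by $a,b_\omega,c_\omega,d_\omega$, where $a(0\eta)=1\eta$, $a(1\eta)=0\eta$, and for all $\eta\in\{0,1\}^{\mathbb{N}}$, $l\in\{0,1,2\}$, $\omega\in\{0,1,2\}^{\mathbb{N}}$: $b_{2\omega}(0\eta)=c_{1\omega}(0\eta)=d_{0\omega}(0\eta)=0\eta$; $b_{0\omega}(0\eta)=b_{1\omega}(0\eta)=c_{0\omega}(0\eta)=c_{2\omega}(0\eta)=d_{1\omega}(0\eta)=d_{2\omega}(0\eta)=0a(\eta)$; $b_{l\omega}(1\eta)=1b_\omega(\eta)$, $c_{l\omega}(1\eta)=1c_\omega(\eta)$, $d_{l\omega}(1\eta)=1d_\omega(\eta)$. The generators are involutions and $b_\omega=c_\omega d_\omega$, so $a,c_\omega,d_\omega$ generate $\mathcal{G}_\omega$. Here $\omega=(01)^\infty=010101\ldots$. The subshift. Let $\mathcal{A}=\{a,c,d\}$ (letters). $\mathcal{A}^{\mathbb{Z}}$ is the set of bi-infinite strings $\ldots x_{-1}x_0.x_1x_2\ldots$ with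 the product topology; the shift $\sigma$ is given by $(\sigma(\omega))(n)=\omega(n+1)$. $\xi_{\mathrm{Mu}}\in\{a,c,d\}^{\mathbb{N}}$ is the unique infinite string beginning with $a$ preserved by the substitution $a\to aca$, $c\to d$, $d\to c$ (applied letter by letter with concatenation). $\Omega(\xi_{\mathrm{Mu}})$ is the set of all $\omega\in\mathcal{A}^{\mathbb{Z}}$ such that every (finite, nonempty, contiguous) subword of $\omega$ is a subword of $\xi_{\mathrm{Mu}}$; it is a $\sigma$-invariant Cantor set, and $\sigma|\Omega(\xi_{\mathrm{Mu}})$ is the restriction of the shift. For a homeomorphism $T:X\to X$ of a Cantor set, the topological full group $[[T]]$ is the group of all homeomorphisms $F:X\to X$ of the form $F(x)=T^{\nu(x)}(x)$ with $\nu:X\to\mathbb{Z}$ continuous. Strings in $\Omega(\xi_{\mathrm{Mu}})$ have no double letters. For $z\in\{a,c,d\}$, the map $\delta_z$ of $\Omega(\xi_{\mathrm{Mu}})$ is defined for $\omega=\ldots x_{-1}x_0.x_1x_2\ldots$ by $\delta_z(\omega)=\sigma(\omega)$ if $x_1=z$, $\delta_z(\omega)=\sigma^{-1}(\omega)$ if $x_0=z$, and $\delta_z(\omega)=\omega$ otherwise; it is an involution in $[[\sigma|\Omega(\xi_{\mathrm{Mu}})]]$. *)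

(* Defs.v *)
From HB Require Import structures.
From mathcomp Require Import all_boot all_order all_algebra.
From mathcomp Require Import all_classical topology.
From mathcomp Require Import zify.

Set Implicit Arguments.
Unset Strict Implicit.
Unset Printing Implicit Defensive.

Import GRing.Theory.

Local Open Scope classical_set_scope.
Local Open Scope group_scope.

Record sym (X : Type) := Sym {
  sym_fun :> X -> X;
  sym_inv : X -> X;
  sym_funK : cancel sym_fun sym_inv;
  sym_invK : cancel sym_inv sym_fun }.

Lemma sym_ext (X : Type) (f g : sym X) : f =1 g -> f = g.
Proof.
case: f g => [f f' fK f'K] [g g' gK g'K] /= /funext fg; subst g.
have e : f' = g' by apply: funext => x; rewrite -{1}[x]g'K fK.
by subst g'; congr Sym; apply: Prop_irrelevance.
Qed.

Definition sym_one (X : Type) : sym X :=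
  @Sym X id id (fun=> erefl) (fun=> erefl).

(* Transformations act on the left: [(f * g) x = f (g x)]. *)
Definition sym_mul (X : Type) (f g : sym X) : sym X :=
  Sym (can_comp (sym_funK f) (sym_funK g))
      (can_comp (sym_invK g) (sym_invK f)).

Definition sym_opp (X : Type) (f : sym X) : sym X :=
  Sym (sym_invK f) (sym_funK f).

HB.instance Definition _ (X : Type) := gen_eqMixin (sym X).
HB.instance Definition _ (X : Type) := gen_choiceMixin (sym X).

Lemma sym_mulA (X : Type) : associative (@sym_mul X).
Proof. by move=> f g h; apply: sym_ext. Qed.
Lemma sym_mul1 (X : Type) : left_id (sym_one X) (@sym_mul X).
Proof. by move=> f; apply: sym_ext. Qed.
Lemma sym_mulr1 (X : Type) : right_id (sym_one X) (@sym_mul X).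
Proof. by move=> f; apply: sym_ext. Qed.
Lemma sym_mulV (X : Type) : left_inverse (sym_one X) (@sym_opp X) (@sym_mul X).
Proof. by move=> f; apply: sym_ext => x /=; rewrite sym_funK. Qed.
Lemma sym_mulrV (X : Type) :
  right_inverse (sym_one X) (@sym_opp X) (@sym_mul X).
Proof. by move=> f; apply: sym_ext => x /=; rewrite sym_invK. Qed.

HB.instance Definition _ (X : Type) := isGroup.Build (sym X)
  (@sym_mulA X) (@sym_mul1 X) (@sym_mulr1 X) (@sym_mulV X) (@sym_mulrV X).

Definition is_subgroup (G : groupType) (A : set G) : Prop :=
  A 1 /\ (forall x y, A x -> A y -> A (x / y)).

Record subgroup (G : groupType) := Subgroup {
  carrier : set G;
  carrierP : is_subgroup carrier }.

Definition subgroup_type (G : groupType) (H : subgroup G) : Type :=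
  set_type (carrier H).
Coercion subgroup_type : subgroup >-> Sortclass.

Lemma carrier_closed (G : groupType) (H : subgroup G) :
  group_closed [pred x | x \in carrier H].
Proof.
case: (carrierP H) => H1 HD; split=> [|x y]; rewrite !inE //; exact: HD.
Qed.

HB.instance Definition _ (G : groupType) (H : subgroup G) :=
  SubChoice.on (subgroup_type H).
HB.instance Definition _ (G : groupType) (H : subgroup G) :=
  SubChoice_isSubGroup.Build G [pred x | x \in carrier H] (subgroup_type H)
    (carrier_closed H).

Definition elt (G : groupType) (H : subgroup G) (x : G) (Hx : carrier H x) : H :=
  exist _ x (mem_set Hx).

Lemma generated_subproof (G : groupType) (S : set G) :
  is_subgroup (smallest (@is_subgroup G) S).
Proof.
split=> [A [[A1 _] _] //|x y Hx Hy A HA].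
by case: (HA) => -[_ AD] _; apply: AD; [exact: Hx|exact: Hy].
Qed.

Definition generated (G : groupType) (S : set G) : subgroup G :=
  Subgroup (generated_subproof S).

Lemma generated_incl (G : groupType) (S : set G) x :
  S x -> carrier (generated S) x.
Proof. by move=> Sx A [_ SA]; exact: SA. Qed.

Definition expgz (G : groupType) (x : G) (n : int) : G :=
  match n with
  | Posz k => x ^+ k
  | Negz k => x ^- k.+1
  end.

Lemma expgzD (G : groupType) (x : G) (m n : int) :
  expgz x (m + n)%R = expgz x m * expgz x n.
Proof.
have key (i j : nat) : expgz x (i%:Z - j%:Z)%R = x ^+ i / x ^+ j.
  have [le_ji|lt_ij] := leqP j i.
    by rewrite -{2}(subnK le_ji) expgnDr mulgK subzn.
  have -> : (i%:Z - j%:Z)%R = Negz (j - i).-1 by lia.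
  rewrite /= prednK ?subn_gt0 // -[in RHS](subnK (ltnW lt_ij)) expgnDr invgM.
  by rewrite mulgA mulgV mul1g.
have com (i j : nat) : x ^+ i / x ^+ j = x ^- j * x ^+ i.
  apply: (mulIg (x ^+ j)).
  by rewrite mulgVK -mulgA -expgnDr addnC expgnDr mulKg.
case: m n => [m|m] [n|n]; rewrite ?NegzE.
- by rewrite -PoszD /= expgnDr.
- by rewrite key -NegzE.
- by rewrite addrC key com -NegzE.
- have -> : (- m.+1%:Z - n.+1%:Z)%R = Negz (n + m).+1 by lia.
  by rewrite -!NegzE /= -addnS -addSn expgnDr invgM.
Qed.

Lemma homeo_subproof (X : topologicalType) : is_subgroup
  [set f : sym X | continuous (sym_fun f) /\ continuous (sym_inv f)].
Proof.
split=> [|f g [fc fVc] [gc gVc]]; first by split=> x.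
split=> x.
- exact: (@continuous_comp _ _ _ (sym_inv g) (sym_fun f) x
    (gVc x) (fc _)).
- exact: (@continuous_comp _ _ _ (sym_inv f) (sym_fun g) x
    (fVc x) (gc _)).
Qed.

Definition homeo (X : topologicalType) : subgroup (sym X) :=
  Subgroup (homeo_subproof X).

Definition homeo_fun (X : topologicalType) (f : homeo X) : X -> X :=
  sym_fun (\val f).

Lemma homeo_ext (X : topologicalType) (f g : homeo X) :
  homeo_fun f =1 homeo_fun g -> f = g.
Proof. by move=> fg; apply: val_inj; apply: sym_ext. Qed.

Lemma homeo_continuous (X : topologicalType) (f : homeo X) :
  continuous (homeo_fun f).
Proof. by case: f => f /= fP; case: (set_mem fP). Qed.

Lemma homeo_mulE (X : topologicalType) (f g : homeo X) x :
  homeo_fun (f * g) x = homeo_fun f (homeo_fun g x).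
Proof. by []. Qed.

Lemma homeo_oneE (X : topologicalType) x : homeo_fun (1 : homeo X) x = x.
Proof. by []. Qed.

Lemma continuous_discreteP (X : topologicalType) (T : choiceType)
    (nu : X -> discrete_topology T) :
  continuous nu <-> forall x, \forall y \near x, nu y = nu x.
Proof.
split=> [nuc x|H x A].
  by apply: (nuc x [set z | z = nu x]); apply/principal_filterP.
move=> /principal_filterP Ax; rewrite /nbhs /=.
by apply: filterS (H x) => y /= ->.
Qed.

Definition in_full_group (X : topologicalType) (T : homeo X) (F : homeo X) :=
  exists nu : X -> discrete_topology int,
    continuous nu /\ forall x, homeo_fun F x = homeo_fun (expgz T (nu x)) x.

Lemma full_group_subproof (X : topologicalType) (T : homeo X) :
  is_subgroup [set F : homeo X | in_full_group T F].
Proof.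
split=> [|F G [nu [nuc HF]] [mu [muc HG]]].
  by exists (fun=> 0%R); split=> // x; apply: cst_continuous.
have GVc := @homeo_continuous X (G^-1)%g.
pose Gi := homeo_fun G^-1.
have GiK x : homeo_fun G (Gi x) = x by rewrite /Gi -homeo_mulE mulgV.
have Hinv x : Gi x = homeo_fun (expgz T (- mu (Gi x))%R) x.
  by rewrite -{3}(GiK x) HG -homeo_mulE -expgzD addNr.
exists (fun x => nu (Gi x) + - mu (Gi x))%R.
split=> [|x]; last by rewrite expgzD !homeo_mulE -Hinv -HF.
apply/continuous_discreteP => x.
have /continuous_discreteP/(_ (Gi x)) nun := nuc.
have /continuous_discreteP/(_ (Gi x)) mun := muc.
have := GVc x _ nun; have := GVc x _ mun; rewrite /nbhs /=.
by apply: filterS2 => y; rewrite /= -/Gi => -> ->.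
Qed.

Definition full_group (X : topologicalType) (T : homeo X) : subgroup (homeo X) :=
  Subgroup (full_group_subproof T).

(* An infinite string is a function on [nat], so that its
   first letter has index 0; the letters 0 and 1 of the tree alphabet are
   [false] and [true]. *)

Definition str (T : Type) := nat -> T.
Definition scons (T : Type) (x : T) (s : str T) : str T :=
  fun n => if n is m.+1 then s m else x.
Definition stail (T : Type) (s : str T) : str T := fun n => s n.+1.

Definition flip (eta : str bool) : str bool :=
  scons (~~ eta 0%N) (stail eta).

(* The common shape of b, c and d (k = 2, 1, 0 respectively): on 1^m 0 eta the
   map applies [flip] to eta unless the letter of omega at position m is [k]. *)
Fixpoint spinal (k : 'I_3) (omega : str 'I_3) (eta : str bool) (n : nat)
    {struct n} : bool :=
  if eta 0%N then
    if n is m.+1 then spinal k (stail omega) (stail eta) m else true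
  else if omega 0%N == k then eta n
  else scons false (flip (stail eta)) n.

Lemma spinal1 k l omega eta :
  spinal k (scons l omega) (scons true eta) = scons true (spinal k omega eta).
Proof. by apply: funext => -[|n]. Qed.

Lemma spinal0_fix k omega eta :
  spinal k (scons k omega) (scons false eta) = scons false eta.
Proof. by apply: funext => -[|n] /=; rewrite eqxx. Qed.

Lemma spinal0_flip k l omega eta : l != k ->
  spinal k (scons l omega) (scons false eta) = scons false (flip eta).
Proof. by move=> /negPf lk; apply: funext => -[|n] /=; rewrite lk. Qed.

Lemma sconsE (T : Type) (s : str T) : s = scons (s 0%N) (stail s).
Proof. by apply: funext => -[]. Qed.

Lemma flipK : involutive flip.
Proof. by move=> eta; apply: funext => -[|n] //=; rewrite negbK. Qed.

Lemma spinalK k omega : involutive (spinal k omega).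
Proof.
move=> eta; apply: funext => n; elim: n omega eta => [|n IHn] omega eta.
all: rewrite (sconsE omega) (sconsE eta).
all: move: (omega 0%N) (stail omega) (eta 0%N) (stail eta) => l w [] s.
all: rewrite ?spinal1 //; try exact: IHn.
all: by have [->|lk] := eqVneq l k;
  rewrite ?spinal0_fix // !spinal0_flip // flipK.
Qed.

Definition sym_a : sym (str bool) := Sym flipK flipK.
Definition sym_spinal k omega : sym (str bool) :=
  Sym (spinalK k omega) (spinalK k omega).
Definition sym_b := sym_spinal (2%R : 'I_3).
Definition sym_c := sym_spinal (1%R : 'I_3).
Definition sym_d := sym_spinal (0%R : 'I_3).

Definition grig (omega : str 'I_3) : subgroup (sym (str bool)) :=
  generated [set sym_a; sym_b omega; sym_c omega; sym_d omega].

Lemma grig_aP omega : carrier (grig omega) sym_a.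
Proof. by apply: generated_incl; do 3 left. Qed.
Lemma grig_cP omega : carrier (grig omega) (sym_c omega).
Proof. by apply: generated_incl; left; right. Qed.
Lemma grig_dP omega : carrier (grig omega) (sym_d omega).
Proof. by apply: generated_incl; right. Qed.

Definition grig_a omega : grig omega := elt (@grig_aP omega).
Definition grig_c omega : grig omega := elt (@grig_cP omega).
Definition grig_d omega : grig omega := elt (@grig_dP omega).

Definition omega01 : str 'I_3 := fun n => if odd n then 1%R else 0%R.

Inductive letter := La | Lc | Ld.

Definition ord_of_letter (x : letter) : 'I_3 :=
  match x with La => 0%R | Lc => 1%R | Ld => 2%R end.
Definition letter_of_ord (i : 'I_3) : letter :=
  match val i with 0%N => La | 1%N => Lc | _ => Ld end.
Lemma ord_of_letterK : cancel ord_of_letter letter_of_ord.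
Proof. by case. Qed.

HB.instance Definition _ := Countable.copy letter (can_type ord_of_letterK).
HB.instance Definition _ := hasNbhs.Build letter principal_filter.
HB.instance Definition _ := Discrete_ofNbhs.Build letter erefl.

Definition mu_letter (x : letter) : seq letter :=
  match x with La => [:: La; Lc; La] | Lc => [:: Ld] | Ld => [:: Lc] end.

Definition mu_word (w : seq letter) : seq letter := flatten (map mu_letter w).

(* Images of letters are nonempty, so the image of the prefix of length n+1 is a
   prefix of the (infinite) image that contains the position n. *)
Definition mu_str (x : str letter) : str letter :=
  fun n => nth La (mu_word (mkseq x n.+1)) n.

Definition is_xi_Mu (x : str letter) : Prop := x 0%N = La /\ mu_str x = x.

Definition xi_Mu : str letter := xget (fun=> La) is_xi_Mu.

Lemma mu_word_cat u v : mu_word (u ++ v) = mu_word u ++ mu_word v.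
Proof. by rewrite /mu_word map_cat flatten_cat. Qed.

Lemma size_mu_word w : (size w <= size (mu_word w))%N.
Proof. by elim: w => //= -[] w IHw; rewrite /mu_word /= -/(mu_word _); lia. Qed.

Lemma mu_word_mkseqD x m n : exists v, mu_word (mkseq x (m + n)) =
  mu_word (mkseq x m) ++ v.
Proof. by rewrite /mkseq iotaD map_cat mu_word_cat; eexists. Qed.

Lemma mu_strE x n m : (n < m)%N -> mu_str x n = nth La (mu_word (mkseq x m)) n.
Proof.
move=> lt_nm; rewrite -(subnKC lt_nm).
have [v ->] := mu_word_mkseqD x n.+1 (m - n.+1).
rewrite nth_cat /mu_str ifT //.
by apply: leq_trans (size_mu_word _); rewrite size_mkseq.
Qed.

Lemma is_xi_Mu_unique x y : is_xi_Mu x -> is_xi_Mu y -> x = y.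
Proof.
move=> [x0 xmu] [y0 ymu]; apply: funext => n.
have [m] := ubnP n; elim: m n => // m IHm n /ltnSE le_nm.
have [->|n_gt0] := posnP n; first by rewrite x0 y0.
have key z : z 0%N = La -> mu_str z = z ->
    z n = nth La (mu_word (mkseq z n)) n.
  move=> z0 zmu; rewrite -{1}zmu (@mu_strE _ _ n.+1) // -addn1.
  have [v ->] := mu_word_mkseqD z n 1; rewrite nth_cat ifT //.
  case: {IHm le_nm} n n_gt0 v => // n _ _.
  rewrite /mkseq /= z0 /mu_word /= -/(mu_word _) !ltnS.
  by apply: leqW; rewrite (leq_trans _ (size_mu_word _)) ?size_map ?size_iota.
rewrite (key x) // (key y) //; congr (nth La (mu_word _) n).
apply/eq_in_map => i; rewrite mem_iota add0n => /andP[_ lt_in].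
exact: IHm (leq_trans lt_in le_nm).
Qed.

(* A closed form of the fixed string, used to show that it exists. *)
Definition xi_toeplitz : str letter := fun n =>
  if ~~ odd n then La else if odd (logn 2 n.+1) then Lc else Ld.

Lemma xi_toeplitz_is_xi_Mu : is_xi_Mu xi_toeplitz.
Proof.
set x := xi_toeplitz.
have xe k : x k.*2 = La by rewrite /x /xi_toeplitz odd_double.
have x2 k : mu_letter (x k.*2.+1) = [:: x k.*2.*2.+3].
  rewrite /x /xi_toeplitz /= !odd_double /=.
  have -> : k.*2.*2.+4 = (2 * k.*2.+2)%N by lia.
  by rewrite lognM // add1n /=; case: (odd _).
have x1 k : x k.*2.*2.+1 = Lc.
  rewrite /x /xi_toeplitz /= odd_double /=.
  have -> : k.*2.*2.+2 = (2 * k.*2.+1)%N by lia.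
  by rewrite lognM // [logn 2 k.*2.+1]lognE dvdn2 oddS odd_double.
have pre k : mu_word (mkseq x k.*2) = mkseq x k.*2.*2.
  elim: k => // k IHk.
  rewrite !doubleS -(addn2 k.*2) -(addn4 k.*2.*2) /mkseq !iotaD !map_cat.
  rewrite mu_word_cat -!/(mkseq _ _) IHk; congr (_ ++ _).
  rewrite !add0n /= xe /mu_word /= x2 xe x1.
  by have -> : k.*2.*2.+2 = (k.*2.+1).*2 by []; rewrite xe.
split=> //; apply: funext => n.
by rewrite (@mu_strE _ _ n.+1.*2) ?pre ?nth_mkseq //; lia.
Qed.

Lemma xi_MuP : is_xi_Mu xi_Mu.
Proof.
by rewrite /xi_Mu; case: xgetP => // /(_ _ xi_toeplitz_is_xi_Mu).
Qed.

(* The string ... x_{-1} x_0 . x_1 x_2 ... is the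
   function [n |-> x_n]. *)

Definition full_shift : topologicalType := prod_topology (fun _ : int => letter).

Definition subword_bi (w : seq letter) (x : full_shift) : Prop :=
  exists i : int, w = mkseq (fun k => x (i + k%:Z)%R) (size w).

Definition subword_inf (w : seq letter) (x : str letter) : Prop :=
  exists j : nat, w = mkseq (fun k => x (j + k)%N) (size w).

Definition Omega (xi : str letter) : set full_shift :=
  [set x | forall w, w != [::] -> subword_bi w x -> subword_inf w xi].

Definition shift_by (m : int) (x : full_shift) : full_shift :=
  fun n => x (n + m)%R.

Lemma shift_by_Omega (xi : str letter) m x :
  Omega xi x -> Omega xi (shift_by m x).
Proof.
move=> xP w w0 [i wE]; apply: xP => //; exists (i + m)%R.
rewrite {1}wE; apply: eq_mkseq => k; rewrite /shift_by.
by congr (x _); rewrite -!addrA [(m + _)%R]addrC.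
Qed.

Definition shift_on (xi : str letter) m (x : Omega xi) : Omega xi :=
  exist _ (shift_by m (\val x)) (mem_set (@shift_by_Omega xi m _ (set_valP x))).

Lemma shift_onK (xi : str letter) m n : (m + n = 0)%R ->
  cancel (@shift_on xi m) (@shift_on xi n).
Proof.
move=> mn0 x; apply: val_inj => /=; apply: funext => i.
by rewrite /shift_by -addrA [(n + m)%R]addrC mn0 addr0.
Qed.

Lemma shift_by_continuous m : continuous (shift_by m).
Proof.
move=> x; have Ff : Filter (shift_by m @ x) := fmap_filter _ (nbhs_filter x).
apply/cvg_sup => i; apply/cvg_image.
  by rewrite eqEsubset; split=> // y _; exists (fun=> y).
move=> B nB; exists (@proj int (fun=> letter) i @^-1` B).
  exact: (@proj_continuous int (fun=> letter) (i + m)%R x B nB).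
by rewrite image_preimage // eqEsubset; split=> // y _; exists (fun=> y).
Qed.

Lemma shift_on_continuous (xi : str letter) m : continuous (@shift_on xi m).
Proof.
apply: continuous_comp_initial.
move=> x; apply: (@continuous_comp _ _ _ set_val (shift_by m) x).
  exact: initial_continuous.
exact: shift_by_continuous.
Qed.

Definition sigma_sym (xi : str letter) : sym (Omega xi) :=
  Sym (@shift_onK xi 1 (- 1) (subrr _)) (@shift_onK xi (- 1) 1 (addNr _)).

Lemma sigmaP (xi : str letter) : carrier (homeo (Omega xi)) (sigma_sym xi).
Proof. by split; exact: shift_on_continuous. Qed.

Definition sigma (xi : str letter) : homeo (Omega xi) := elt (@sigmaP xi).

Definition delta (xi : str letter) (z : letter) (x : Omega xi) : Omega xi :=
  if \val x 1%R == z then homeo_fun (sigma xi) x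
  else if \val x 0%R == z then homeo_fun (sigma xi)^-1 x
  else x.

(* Main.v *)
(* By definition of the action, the orbit of 1^oo is a ray whose edges are
   labelled by xi_Mu: the n-th vertex is a Gray code of n. Gluing two copies of
   the ray along an edge labelled c gives an equivariant map from the line with
   edge labels [axis], a point of Omega(xi_Mu), to the tree boundary, while
   delta_z moves a point of Omega(xi_Mu) one step along its own line of shifts.
   Hence words in a, c, d give the same transformation on both sides. If they
   agree on the tree, then they agree on Omega(xi_Mu), because every window of a
   point of Omega(xi_Mu) occurs in the ray and the vertices of the ray are
   distinct. If they agree on Omega(xi_Mu), then they agree on the ray, because
   [axis] is aperiodic, and the ray is dense in the tree boundary. *)

Require Import Defs.
From HB Require Import structures.
From mathcomp Require Import all_boot all_order all_algebra.
From mathcomp Require Import all_classical topology.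
From mathcomp Require Import zify.

Set Implicit Arguments.
Unset Strict Implicit.
Unset Printing Implicit Defensive.

Local Open Scope classical_set_scope.

(** * Homomorphisms defined on words in the generators *)

Definition weval (G : groupType) (f : letter -> G) (w : seq letter) : G :=
  foldr (fun z g => (f z * g)%g) 1%g w.

Lemma weval_cat (G : groupType) (f : letter -> G) u v :
  weval f (u ++ v) = (weval f u * weval f v)%g.
Proof. by elim: u => [|z u /= ->]; rewrite ?mul1g ?mulgA. Qed.

Lemma weval_rev (G : groupType) (f : letter -> G) w :
  (forall z, (f z * f z = 1)%g) -> weval f (rev w) = ((weval f w)^-1)%g.
Proof.
move=> ff; elim: w => [|z w IHw]; first by rewrite invg1.
rewrite rev_cons -cats1 weval_cat IHw /= mulg1 invgM; congr (_ * _)%g.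
by apply: (mulgI (f z)); rewrite ff mulgV.
Qed.

Section WordMorphism.
Variables (G H : groupType) (f : letter -> G) (k : letter -> H).
Hypothesis f_gen : forall g, exists w, weval f w = g.
Hypothesis fk : forall u v, weval f u = weval f v <-> weval k u = weval k v.

Let h g := weval k (sval (cid (f_gen g))).

Let h_weval w : h (weval f w) = weval k w.
Proof. by apply/fk; exact: svalP (cid (f_gen (weval f w))). Qed.

Let hM : {morph h : x y / (x * y)%g}.
Proof.
move=> x y; have [u <-] := f_gen x; have [v <-] := f_gen y.
by rewrite -weval_cat !h_weval weval_cat.
Qed.

HB.instance Definition _ := isMultiplicative.Build G H h hM.

(** [fk] from left to right makes [h] independent of the chosen word; from right to left it makes
    [h] injective. *)
Lemma word_morphism : exists h : {multiplicative G -> H},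
  injective h /\ forall z, h (f z) = k z.
Proof.
exists h; split=> [x y|z].
  have [u <-] := f_gen x; have [v <-] := f_gen y.
  by move=> /= huv; apply/fk; rewrite -!h_weval.
by have := h_weval [:: z]; rewrite /= !mulg1.
Qed.

End WordMorphism.

(** * The group generated by a, c, d on the tree boundary *)

Definition tree_gen (z : letter) : grig omega01 :=
  match z with
  | La => grig_a omega01 | Lc => grig_c omega01 | Ld => grig_d omega01
  end.

Definition tree_act (z : letter) : str bool -> str bool :=
  sym_fun (\val (tree_gen z)).

Lemma tree_actK z : involutive (tree_act z).
Proof. by case: z => eta; [exact: flipK|exact: spinalK|exact: spinalK]. Qed.

Lemma tree_genK z : (tree_gen z * tree_gen z = 1)%g.
Proof. by apply: val_inj; apply: sym_ext => eta; apply: tree_actK. Qed.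

Lemma weval_tree_act w eta :
  sym_fun (\val (weval tree_gen w)) eta = foldr tree_act eta w.
Proof. by elim: w => //= z w <-. Qed.

(** As [omega] avoids 2, b flips after every prefix 1^m 0, while exactly one of c and d does. *)
Lemma spinal_cd omega eta : (forall n, omega n = 0%R \/ omega n = 1%R) ->
  spinal 2%R omega eta = spinal 1%R omega (spinal 0%R omega eta).
Proof.
move=> omega01; apply: funext => n.
elim: n omega eta omega01 => [|n IHn] omega eta omega01.
all: have := omega01 0%N.
all: have omega01' : forall n, stail omega n = 0%R \/ stail omega n = 1%R
  by move=> ?; apply: omega01.
all: rewrite (sconsE omega) (sconsE eta) [scons _ _ 0%N]/=.
all: case: (eta 0%N) => l01; rewrite ?spinal1 //= ?IHn //.
all: case: l01 => ->.
all: by rewrite ?(spinal0_fix, spinal0_flip).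
Qed.

Lemma tree_gen_generates (g : grig omega01) : exists w, weval tree_gen w = g.
Proof.
case: g => g' gP; have /set_mem gP' := gP.
pose A : set (sym (str bool)) :=
  [set s | exists w, \val (weval tree_gen w) = s].
suff [w wE] : A g' by exists w; apply: val_inj.
apply: gP'; split.
  split=> [|x y [u <-] [v <-]]; first by exists [::].
  by exists (u ++ rev v); rewrite weval_cat (weval_rev _ tree_genK).
move=> x [[[->|->]|->]|->].
- by exists [:: La]; apply: sym_ext.
- exists [:: Lc; Ld]; apply: sym_ext => eta.
  rewrite weval_tree_act; apply/esym/spinal_cd => n.
  by rewrite /omega01; case: (odd n); [right|left].
- by exists [:: Lc]; apply: sym_ext.
- by exists [:: Ld]; apply: sym_ext.
Qed.

(** * Gray code and the orbit of 1^oo *)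

(** The complement of the reflected binary Gray code, lowest bit first, so that [gray 0] is 1^oo. *)
Fixpoint gray (n i : nat) : bool :=
  if i is i'.+1 then gray n./2 i' else odd n == odd n./2.

Lemma gray_scons n : gray n = scons (odd n == odd n./2) (gray n./2).
Proof. by apply: funext => -[]. Qed.

Lemma gray_inj : injective gray.
Proof.
move=> m n; have [b] := ubnP (m + n); elim: b m n => // b IHb m n mnb e.
have [m_n0|mn_gt0] := posnP (m + n)%N; first by lia.
have e2 : m./2 = n./2.
  by apply: IHb; [lia|move/(congr1 (@stail _)): e].
have mn : odd m = odd n.
  move/(congr1 (fun s => s 0%N)): e; rewrite /= e2.
  by case: (odd m); case: (odd n); case: (odd _).
lia.
Qed.

Lemma gray_dense eta N : exists n, forall i, (i < N)%N -> gray n i = eta i.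
Proof.
elim: N eta => [|N IHN] eta; first by exists 0%N.
have [m mE] := IHN (stail eta).
(* Comparison with [odd m] is an involution on bits, so this lowest bit produces the digit
   [eta 0]. *)
exists ((odd m == eta 0%N) + m.*2)%N => -[_|i lt_iN] /=.
  rewrite half_bit_double oddD odd_double oddb addbF.
  by case: (odd m) (eta 0%N) => -[].
by rewrite half_bit_double mE.
Qed.

Lemma flip_gray_double j : flip (gray j.*2) = gray j.*2.+1.
Proof.
rewrite (gray_scons j.*2) (gray_scons j.*2.+1) /=.
rewrite odd_double uphalf_double doubleK.
by apply: funext => -[|i] //=; case: (odd j).
Qed.

Lemma spinal_gray0 k omega : spinal k omega (gray 0) = gray 0.
Proof.
apply: funext => n.
elim: n omega => [//|n IHn] omega.
by rewrite gray_scons (sconsE omega) spinal1 /= IHn.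
Qed.

(* The Gray code turns the orbit of 1^oo into a ray whose edge between
   [2 j - 1] and [2 j] changes the bit following the prefix 1^m 0, where
   [m = logn 2 j]. *)
Lemma spinal_gray k omega j : (0 < j)%N ->
  let t := (omega (logn 2 j) == k) in
  spinal k omega (gray j.*2.-1) = gray (if t then j.*2.-1 else j.*2) /\
  spinal k omega (gray j.*2) = gray (if t then j.*2 else j.*2.-1).
Proof.
have [b] := ubnP j; elim: b j omega => // b IHb j omega /ltnSE le_jb j_gt0.
have halfp : (j.*2.-1)./2 = j.-1 by lia.
have oddp : odd j.*2.-1 by lia.
have e1 : gray j.*2.-1 = scons (odd j.-1) (gray j.-1).
  by rewrite gray_scons halfp oddp.
have e2 : gray j.*2 = scons (~~ odd j) (gray j).
  by rewrite gray_scons doubleK odd_double; case: (odd j).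
(* For odd [j] both strings start with 0 and their tails [gray j.-1], [gray j] differ by a flip. For
   even [j] both start with 1 and the tails are the same kind of pair for [j./2], with [omega]
   shifted. *)
have [oj|ej] := boolP (odd j).
  rewrite lognE dvdn2 oj j_gt0 /=.
  have fj : flip (gray j.-1) = gray j.
    have -> : j.-1 = (j./2).*2 by lia.
    rewrite flip_gray_double; congr gray; lia.
  rewrite e1 e2 oj /=; have -> : odd j.-1 = false by lia.
  rewrite (sconsE omega) /=; have [->|lk] := eqVneq (omega 0%N) k.
    by rewrite !spinal0_fix e1 e2 oj; have -> : odd j.-1 = false by lia.
  rewrite !spinal0_flip // fj -fj flipK e1 e2 oj.
  by rewrite fj; have -> : odd j.-1 = false by lia.
have [i jE] : exists i, j = i.*2 by exists j./2; lia.
have i_gt0 : (0 < i)%N by lia.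
have lj : logn 2 j = (logn 2 i).+1.
  by rewrite jE -muln2 lognM // addn1.
have oj1 : odd j.-1 by lia.
have [] := IHb i (stail omega) _ i_gt0; first by lia.
rewrite /= lj -[stail omega _]/(omega (logn 2 i).+1) -jE => h1 h2.
rewrite e1 e2 (negPf ej) oj1 (sconsE omega) !spinal1 h1 h2 /=.
by case: ifP => _; rewrite ?e1 ?e2 ?oj1 ?(negPf ej).
Qed.

(** * Edge labels along the ray *)

Local Notation xi := xi_toeplitz.

Lemma xi_even j : xi j.*2 = La.
Proof. by rewrite /xi_toeplitz odd_double. Qed.

Lemma xi_odd j : (0 < j)%N -> xi j.*2.-1 = if odd (logn 2 j) then Ld else Lc.
Proof.
move=> j_gt0; have oj : odd j.*2.-1 by lia.
rewrite /xi_toeplitz oj /= prednK ?double_gt0 // -muln2 lognM // addn1 /=.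
by case: (odd _).
Qed.

Lemma omega01_eq1 m : (omega01 m == 1%R) = odd m.
Proof. by rewrite /omega01; case: (odd m). Qed.

Lemma omega01_eq0 m : (omega01 m == 0%R) = ~~ odd m.
Proof. by rewrite /omega01; case: (odd m). Qed.

Lemma tree_act_La n :
  tree_act La (gray n) = gray (if odd n then n.-1 else n.+1).
Proof.
rewrite /tree_act /= -[n in LHS]odd_double_half; case: ifP => on.
  rewrite -flip_gray_double flipK; congr gray; lia.
rewrite flip_gray_double; congr gray; lia.
Qed.

(** Between [2 j - 1] and [2 j] the letter of [omega01] at [logn 2 j] decides: at an even valuation
    it is 0, so that c flips and d does not; at an odd one the roles are exchanged. These are the
    labels of [xi_odd]. *)
Lemma tree_act_gray n : tree_act (xi n) (gray n) = gray n.+1.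
Proof.
have [on|en] := boolP (odd n).
  have [j [j_gt0 ->]] : exists j, (0 < j)%N /\ n = j.*2.-1.
    by exists (n.+1./2); lia.
  rewrite xi_odd // prednK ?double_gt0 // /tree_act.
  by case: ifP => oj; apply: etrans (spinal_gray _ _ j_gt0).1 _;
    rewrite ?omega01_eq0 ?omega01_eq1 oj.
have -> : n = n./2.*2 by lia.
by rewrite xi_even tree_act_La odd_double.
Qed.

Lemma tree_act_gray_fix z n :
  z != xi n -> (0 < n)%N && (z == xi n.-1) = false ->
  tree_act z (gray n) = gray n.
Proof.
have [j [] nE] : exists j, n = j.*2 \/ n = j.*2.+1.
- exists n./2; lia.
(* The end [gray 0] of the ray has no edge to its left; c and d fix it. *)
- rewrite nE xi_even; have [->|j_gt0] := posnP j.
    by case: z => // _ _; exact: spinal_gray0.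
  rewrite xi_odd // double_gt0 j_gt0 /=.
  by case: z => // _; case: ifP => // oj _;
    apply: etrans (spinal_gray _ _ j_gt0).2 _;
    rewrite ?omega01_eq0 ?omega01_eq1 oj.
- have -> : n = j.+1.*2.-1 by lia.
  rewrite xi_odd // (_ : j.+1.*2.-1.-1 = j.*2) ?xi_even; last by lia.
  by case: z => //; case: ifP => // oj _ _;
    apply: etrans (spinal_gray _ _ (ltn0Sn j)).1 _;
    rewrite ?omega01_eq0 ?omega01_eq1 oj.
Qed.

(** Automorphisms of the rooted tree preserve its levels. *)
Lemma spinal_prefix k omega eta eta' N :
  (forall i, (i < N)%N -> eta i = eta' i) ->
  forall i, (i < N)%N -> spinal k omega eta i = spinal k omega eta' i.
Proof.
elim: N omega eta eta' => // N IHN omega eta eta' e i lt_iN.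
have e' j : (j < N)%N -> stail eta j = stail eta' j by move=> ?; apply: e.
rewrite (sconsE omega) (sconsE eta) (sconsE eta') e //.
case: (eta' 0%N); first by rewrite !spinal1; case: i lt_iN => //= i; apply: IHN.
have [->|lk] := eqVneq (omega 0%N) k.
  by rewrite !spinal0_fix; case: i lt_iN => //= i /e'.
rewrite !spinal0_flip //; case: i lt_iN => // i lt_iN /=.
by have := e' i lt_iN; case: i {lt_iN} => [|i] //=; rewrite /flip /= => ->.
Qed.

Lemma tree_act_prefix z eta eta' N :
  (forall i, (i < N)%N -> eta i = eta' i) ->
  forall i, (i < N)%N -> tree_act z eta i = tree_act z eta' i.
Proof.
case: z => e; [|exact: spinal_prefix e|exact: spinal_prefix e].
by move=> [|i] lt_iN /=; rewrite /tree_act /= ?/stail e.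
Qed.

(** * Walks on labelled lines and the point [axis] *)

(** The edge from [i] to [i + 1] carries [x (i + 1)], in accordance with [delta], which reads x_1
    and x_0. *)
Definition step (x : int -> letter) (z : letter) (i : int) : int :=
  if x (i + 1)%R == z then (i + 1)%R else if x i == z then (i - 1)%R else i.

Lemma xi_MuE : xi_Mu = xi.
Proof. exact: is_xi_Mu_unique xi_MuP xi_toeplitz_is_xi_Mu. Qed.

Lemma xi_neqS n : xi n != xi n.+1.
Proof. by rewrite /xi_toeplitz /=; case: (odd n) => //=; case: ifP. Qed.

(* The central letter may be [Lc] or [Ld]: both occur between two copies of a
   prefix of [xi] and its mirror image, at the positions 2^k. *)
Definition axis : full_shift := fun i =>
  match i with Posz 0 => Lc | Posz n.+1 => xi n | Negz n => xi n end.

Lemma xi_logn m n : (0 < m)%N -> (0 < n)%N -> logn 2 m = logn 2 n ->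
  xi m.-1 = xi n.-1.
Proof.
case: m n => [|m] [|n] // _ _ e; rewrite /xi_toeplitz e.
have : odd m.+1 = odd n.+1.
  by apply: negb_inj; rewrite -!dvdn2 -[2%N](expn1 2) !pfactor_dvdn ?e.
by rewrite /= => /negb_inj ->.
Qed.

(** A valuation below [k] survives addition to, or subtraction from, 2^k. *)
Lemma logn_near_pow2 k m : (0 < m < 2 ^ k)%N ->
  logn 2 (2 ^ k + m) = logn 2 m /\ logn 2 (2 ^ k - m) = logn 2 m.
Proof.
elim: k m => [|k IHk] m; first by case: m => [|[]].
rewrite expnS => /andP[m_gt0 lt_m].
have [om|em] := boolP (odd m).
  have odd0 p : odd p -> logn 2 p = 0%N.
    by move=> op; rewrite lognE dvdn2 op andbF.
  by rewrite !odd0 // ?oddD ?oddB ?oddM ?om //; lia.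
have [i mE] : exists i, m = (2 * i)%N by exists m./2; lia.
have i_gt0 : (0 < i)%N by lia.
rewrite mE -mulnDr -mulnBr !lognM //; try lia.
by have [|-> ->] := IHk i; first by lia.
Qed.

Lemma axis_Omega : Omega xi_Mu axis.
Proof.
move=> w _ [i wE]; rewrite xi_MuE.
(* The window is copied around index [2 ^ k - 1] of [xi], where the two sides mirror each other. The
   letter there is [Lc], as at the centre of [axis], because [k] is odd. *)
have [k ok lt_k] : exists2 k, odd k & (`|i| + size w < 2 ^ k)%N.
  exists (`|i| + size w).*2.+1; first by rewrite /= odd_double.
  by apply: leq_trans (ltn_expl _ (isT : 1 < 2)%N) _; rewrite leq_exp2l //; lia.
have pow_gt0 : (0 < 2 ^ k)%N by rewrite expn_gt0.
(* For [n > 0], [axis] at [n] is [xi] at [n - 1]; hence the shift by one. *)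
have [j jE] : exists j : nat, (Posz j.+1 = Posz (2 ^ k)%N + i)%R.
  by exists (absz (Posz (2 ^ k)%N + i - 1)%R); lia.
exists j; rewrite {1}wE; apply/eq_in_map => t.
rewrite mem_iota add0n => /andP[_ lt_t].
have {}lt_k : (absz i + t < 2 ^ k)%N.
  by apply: leq_ltn_trans lt_k; rewrite leq_add2l ltnW.
have : (Posz (j + t).+1 = Posz (2 ^ k)%N + (i + Posz t))%R by lia.
have : (absz (i + Posz t)%R < 2 ^ k)%N by lia.
rewrite -[(j + t)%N]/((j + t).+1.-1).
move: (i + Posz t)%R (j + t).+1 (ltn0Sn (j + t)) => q p p_gt0 lt_q pE.
case: q lt_q pE => [[|n]|n] lt_q pE; last rewrite NegzE in pE.
- have -> : p = (2 ^ k)%N by lia.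
  have odd_pred : odd (2 ^ k).-1.
    by case: k ok {lt_k lt_q pE jE} pow_gt0 => // k _; rewrite expnS; lia.
  by rewrite /= /xi_toeplitz odd_pred prednK // pfactorK // ok.
- have -> : p = (2 ^ k + n.+1)%N by lia.
  rewrite [axis _]/(xi n.+1.-1); apply: xi_logn => //; first by lia.
  by rewrite (@logn_near_pow2 k n.+1 _).1 //; lia.
- have -> : p = (2 ^ k - n.+1)%N by lia.
  rewrite [axis _]/(xi n.+1.-1); apply: xi_logn => //; first by lia.
  by rewrite (@logn_near_pow2 k n.+1 _).2 //; lia.
Qed.

(** Doubling a position raises its 2-adic valuation by one, which changes [La] to [Lc] and exchanges
    [Lc] and [Ld]. *)
Lemma axis_aperiodic k : (k != 0)%R -> axis k != axis (k + k)%R.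
Proof.
have main n : xi n != xi (n.+1 + n.+1).-1.
  have -> : (n.+1 + n.+1).-1 = n.*2.+1 by lia.
  rewrite /xi_toeplitz /= odd_double /=.
  have -> : n.*2.+2 = (n.+1 * 2)%N by lia.
  rewrite lognM // addn1 /=.
  have [on|en] := boolP (odd n); first by case: (odd _).
  by rewrite lognE dvdn2 /= en.
case: k => [[|n]|n] // _.
  by apply: main.
have -> : (Negz n + Negz n)%R = Negz (n.+1 + n.+1).-1 by lia.
exact: main.
Qed.

(** * The equivariant map from the line to the tree boundary *)

(** The line is folded onto the ray: [-1] and [0] both go to [gray 0], and the edge between them,
    labelled c, becomes a loop since c fixes 1^oo. *)
Definition vertex (i : int) : str bool :=
  gray (match i with Posz n => n | Negz n => n end).

Lemma vertexS i : tree_act (axis (i + 1)%R) (vertex i) = vertex (i + 1)%R.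
Proof.
case: i => n; first by rewrite -PoszD addn1; exact: tree_act_gray.
have -> : (Negz n + 1 = - Posz n)%R by rewrite NegzE; lia.
case: n => [|n]; first exact: spinal_gray0.
by rewrite -NegzE /vertex -tree_act_gray tree_actK.
Qed.

Lemma vertex_pred i : tree_act (axis i) (vertex i) = vertex (i - 1)%R.
Proof. by rewrite -{1 2}(GRing.subrK 1%R i) -vertexS tree_actK. Qed.

Lemma vertex_fix z i : axis (i + 1)%R != z -> axis i != z ->
  tree_act z (vertex i) = vertex i.
Proof.
case: i => n.
  rewrite -PoszD addn1 /= => h1 h2; apply: tree_act_gray_fix.
    by rewrite eq_sym.
  by case: n {h1} h2 => //= n; rewrite eq_sym => /negPf.
have -> : (Negz n + 1 = - Posz n)%R by rewrite NegzE; lia.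
move=> h2 h1; apply: tree_act_gray_fix; first by rewrite eq_sym.
by case: n {h1} h2 => //= n; rewrite eq_sym => /negPf.
Qed.

Lemma tree_act_vertex z i : tree_act z (vertex i) = vertex (step axis z i).
Proof.
rewrite /step; case: eqP => [<-|/eqP h1]; first exact: vertexS.
by case: eqP => [<-|/eqP h2]; [exact: vertex_pred|exact: vertex_fix].
Qed.

(** * The involutions [delta z] in the full group *)

Lemma sigma_expgz (x : str letter) m :
  homeo_fun (expgz (sigma x) m) =1 @shift_on x m.
Proof.
have shiftD p q y : @shift_on x p (shift_on q y) = shift_on (p + q)%R y.
  by apply: val_inj; apply: funext => i; rewrite /= /shift_by -!GRing.addrA.
have shift0 y : @shift_on x 0%R y = y.
  by apply: val_inj; apply: funext => i; rewrite /= /shift_by GRing.addr0.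
have pos n : homeo_fun (sigma x ^+ n)%g =1 @shift_on x (Posz n).
  elim: n => [|n IHn] y; first by rewrite shift0.
  rewrite expgS homeo_mulE IHn -[homeo_fun (sigma x)]/(@shift_on x 1%R) shiftD.
  by congr (shift_on _ _); lia.
case: m => n y; first exact: pos.
rewrite NegzE -[in LHS](shift0 y) -(GRing.subrr (Posz n.+1)) -shiftD -pos.
by rewrite -homeo_mulE /expgz mulVg.
Qed.

Definition jump (x : str letter) (z : letter) (y : Omega x) : int :=
  if \val y 1%R == z then 1%R else if \val y 0%R == z then (- 1)%R else 0%R.

Lemma deltaE x z (y : Omega x) : delta z y = shift_on (jump z y) y.
Proof.
rewrite /delta /jump; case: ifP => // _; case: ifP => // _.
by apply: val_inj; apply: funext => i; rewrite /= /shift_by GRing.addr0.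
Qed.

Lemma jump_near x z (y : Omega x) : \forall y' \near y, jump z y' = jump z y.
Proof.
have coord i : \forall y' \near y, \val y' i = \val y i.
  have := @continuous_comp _ _ _ (set_val : Omega x -> full_shift)
    (@proj int (fun=> letter) i) y
    (@initial_continuous _ _ _ y) (@proj_continuous int (fun=> letter) i _).
  by move=> /(_ [set l | l = \val y i]); apply.
by apply: filterS2 (coord 0%R) (coord 1%R) => y' e0 e1; rewrite /jump e0 e1.
Qed.

(** Near [y] the exponent [jump z] is constant, so [delta z] coincides there with one continuous
    shift. *)
Lemma delta_continuous x z : continuous (@delta x z).
Proof.
move=> y A; rewrite deltaE => /(@shift_on_continuous x (jump z y) y).
have := jump_near z y; rewrite /nbhs /=; apply: filterS2 => y' e.
by rewrite /= deltaE e.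
Qed.

Lemma Omega_neqS (y : Omega xi_Mu) i : \val y i != \val y (i + 1)%R.
Proof.
have [|j] := set_valP y [:: \val y i; \val y (i + 1)%R] isT.
  by exists i; rewrite /= /mkseq /= GRing.addr0.
have := xi_neqS j; rewrite -xi_MuE /mkseq /= => xij [-> ->].
by rewrite addn0 addn1.
Qed.

Lemma delta_shift z m (y : Omega xi_Mu) :
  delta z (shift_on m y) = shift_on (step (\val y) z m) y.
Proof.
rewrite deltaE; apply: val_inj; apply: funext => i.
rewrite /= /shift_by /jump /step /= /shift_by GRing.add0r [(1 + m)%R]GRing.addrC.
case: ifP => _; first by congr (\val y _); lia.
by case: ifP => _; congr (\val y _); lia.
Qed.

(** Without double letters, no two adjacent edges are both labelled [z], so the second application
    crosses the same edge back. *)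
Lemma deltaK z : involutive (@delta xi_Mu z).
Proof.
move=> y; rewrite [X in delta z X]deltaE delta_shift.
apply: val_inj; apply: funext => i /=; rewrite /shift_by.
congr (\val y _); rewrite /jump /step.
have := Omega_neqS y 0%R; have := Omega_neqS y 1%R; have := Omega_neqS y (- 1)%R.
rewrite GRing.add0r GRing.addNr /=.
case: (eqVneq (sval y 1%R) z) => [e1|n1].
  rewrite e1 => _; rewrite eq_sym => /negPf -> _; rewrite ?eqxx; lia.
case: (eqVneq (sval y 0%R) z) => [e0|n0].
  by rewrite GRing.addNr e0 ?eqxx; lia.
by rewrite GRing.add0r (negPf n1) (negPf n0); lia.
Qed.

Definition delta_homeo (z : letter) : homeo (Omega xi_Mu) :=
  @elt _ (homeo (Omega xi_Mu)) (Sym (@deltaK z) (@deltaK z))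
    (conj (@delta_continuous xi_Mu z) (@delta_continuous xi_Mu z)).

Lemma delta_in_full_group z : in_full_group (sigma xi_Mu) (delta_homeo z).
Proof.
exists (jump z); split=> [|y]; last by rewrite sigma_expgz -deltaE.
apply/continuous_discreteP; exact: jump_near.
Qed.

Definition delta_gen (z : letter) : full_group (sigma xi_Mu) :=
  @elt _ (full_group (sigma xi_Mu)) _ (delta_in_full_group z).

(** * Words as walks, and comparison of the two groups *)

Definition walk (x : int -> letter) (w : seq letter) (i : int) : int :=
  foldr (step x) i w.

Lemma tree_act_walk w i :
  sym_fun (\val (weval tree_gen w)) (vertex i) = vertex (walk axis w i).
Proof.
by rewrite weval_tree_act; elim: w => //= z w ->; exact: tree_act_vertex.
Qed.

Lemma delta_walk w i (y : Omega xi_Mu) :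
  homeo_fun (\val (weval delta_gen w)) (shift_on i y) =
  shift_on (walk (\val y) w i) y.
Proof.
elim: w => [//|z w IHw]; rewrite [weval _ _]/= [\val _]gmulfM homeo_mulE IHw.
exact: delta_shift.
Qed.

Lemma step_bound x z i : (`|step x z i| <= `|i|.+1)%N.
Proof. by rewrite /step; case: ifP => _; [|case: ifP => _]; lia. Qed.

Lemma walk_bound x w : (`|walk x w 0| <= size w)%N.
Proof.
elim: w => //= z w IHw.
by apply: leq_trans (step_bound _ _ _) _; rewrite ltnS.
Qed.

(** A walk reads only the letters at its position and the next one; [size w < L] keeps these inside
    the window where [y] and [x] agree. *)
Lemma walk_window x y m L w :
  (forall t : int, (`|t| <= L)%N -> y (m + t)%R = x t) -> (size w < L)%N ->
  walk y w m = (m + walk x w 0)%R.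
Proof.
move=> yx; elim: w => [|z w IHw] /= lt_w; first by rewrite GRing.addr0.
rewrite {}IHw; last by lia.
have b := walk_bound x w.
rewrite /step -GRing.addrA !yx; try lia.
by case: ifP => _; [|case: ifP => _]; lia.
Qed.

Lemma axis_window (y : Omega xi_Mu) (L : nat) : exists2 m : nat, (L <= m)%N &
  forall t : int, (`|t| <= L)%N -> axis (Posz m + t)%R = \val y t.
Proof.
pose w := mkseq (fun k => \val y (- Posz L + Posz k)%R) L.*2.+1.
have [] := set_valP y w isT; first by exists (- Posz L)%R; rewrite size_mkseq.
move=> j; rewrite size_mkseq => wE.
(* The window starts at [- L] and [xi j] is [axis (j + 1)], so the centre lands at [j + L + 1]. *)
exists (j + L).+1; first by lia.
move=> t tL; have := congr1 (nth La ^~ (absz (Posz L + t)%R)) wE.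
rewrite !nth_mkseq; try lia.
have -> : (- Posz L + Posz (absz (Posz L + t)%R))%R = t by lia.
move=> ->.
have -> : (Posz (j + L).+1 + t = Posz (j + absz (Posz L + t)).+1)%R by lia.
by rewrite xi_MuE.
Qed.

Lemma weval_delta_tree u v :
  weval tree_gen u = weval tree_gen v <-> weval delta_gen u = weval delta_gen v.
Proof.
split=> uv; apply: val_inj.
  apply: homeo_ext => y.
  have y0 : y = shift_on 0%R y.
    by apply: val_inj; apply: funext => i; rewrite /= /shift_by GRing.addr0.
  rewrite y0 !delta_walk; congr (shift_on _ y).
  have [m Lm mE] := axis_window y (maxn (size u) (size v)).+1.
  have := congr1 (fun g : grig omega01 => sym_fun (\val g) (vertex (Posz m))) uv.
  have := walk_bound (\val y) u; have := walk_bound (\val y) v.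
  rewrite /= !tree_act_walk !(walk_window mE) ?ltnS ?leq_maxl ?leq_maxr //.
  move: (walk _ u _) (walk _ v _) => p q qv pu.
  (* As [m] is at least the window radius, both walks end at nonnegative positions, where [vertex]
     is the injective [gray] and the fold does no harm. *)
  have [a aE] : exists a : nat, (Posz m + p)%R = Posz a.
    by exists (absz (Posz m + p)%R); lia.
  have [b bE] : exists b : nat, (Posz m + q)%R = Posz b.
    by exists (absz (Posz m + q)%R); lia.
  by rewrite aE bE => /gray_inj; lia.
apply: sym_ext => eta; apply: funext => N.
(* Only digit [N] is compared, so a vertex of the ray sharing [N + 1] digits with [eta] can replace
   it. *)
have [n nE] := gray_dense eta N.+1.
have agree w : sym_fun (\val (weval tree_gen w)) eta N =
    vertex (walk axis w (Posz n)) N.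
  rewrite -tree_act_walk !weval_tree_act.
  suff: forall i, (i < N.+1)%N ->
    foldr tree_act eta w i = foldr tree_act (vertex (Posz n)) w i by apply.
  elim: w => [|z w IHw] /=; first by move=> i /nE.
  exact: tree_act_prefix.
rewrite !agree; congr (vertex _ _).
pose y : Omega xi_Mu := exist _ axis (mem_set axis_Omega).
have := congr1 (fun g : full_group (sigma xi_Mu) =>
  \val (homeo_fun (\val g) (shift_on (Posz n) y))) uv.
rewrite /= !delta_walk /= /shift_by.
(* If the shifts of [axis] by [p] and [q] agree, this coordinate gives equal letters at [p - q] and
   at its double. *)
move: (walk _ u _) (walk _ v _) => p q /(congr1 (fun s => s (p - q - q)%R)).
have -> : (p - q - q + p = (p - q) + (p - q))%R by lia.
have -> : (p - q - q + q = p - q)%R by lia.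
have [-> //|] := eqVneq p q; rewrite -GRing.subr_eq0.
by move=> /axis_aperiodic/eqP ne e; case: ne.
Qed.

Theorem proposition4p6 :
  exists h : {multiplicative grig omega01 -> full_group (sigma xi_Mu)},
    [/\ injective h,
        homeo_fun (\val (h (grig_a omega01))) = delta La,
        homeo_fun (\val (h (grig_c omega01))) = delta Lc
      & homeo_fun (\val (h (grig_d omega01))) = delta Ld].
Proof.
have [h [h_inj hE]] := word_morphism tree_gen_generates weval_delta_tree.
by exists h; split=> //; rewrite ?(hE La) ?(hE Lc) ?(hE Ld).
Qed.
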